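(* Let $L/k$ be any finite field extension, let $n\geq 1$, and let $C$ be an $L$-linear subspace of $L^n$. Then $$C^*=\mathrm{Rsupp}(C)_L.$$ In particular $\dim_L C^*=\mathrm{wt}_R(C)$, so that $\dim_L C\leq \mathrm{wt}_R(C)$, and $\dim_L (L\mathbf{c})^*=\mathrm{wt}_R(\mathbf{c})$ for any $\mathbf{c}\in L^n$.
   Context: For a $k$-subspace $D\subset k^n$, $D_L$ denotes the $L$-linear subspace of $L^n$ generated by $D$. An $L$-linear subspace of $L^n$ is extended from $k^n$ if it is spanned over $L$ by vectors in $k^n$. For an $L$-linear subspace $C\subset L^n$, $C^*$ denotes the intersection of all $L$-linear subspaces of $L^n$ that are extended from $k^n$ and contain $C$. Rank support: let $m=[L:k]$ and fix a $k$-basis $\alpha_1,\ldots,\alpha_m$ of $L$. For $\mathbf{c}=(c_1,\ldots,c_n)\in L^n$ write $c_j=\sum_{i=1}^m c_{ij}\alpha_i$ with $c_{ij}\in k$, and let $M(\mathbf{c})=(c_{ij})$, an $m\times n$ matrix over $k$. Then $\mathrm{Rsupp}(\mathbf{c})$ is the $k$-subspace of $k^n$ spanned by the rows of $M(\mathbf{c})$ (independent of the choice of basis), and $\mathrm{wt}_R(\mathbf{c})=\dim_k\mathrm{Rsupp}(\mathbf{c})$. For an $L$-linear subspace $C\subset L^n$, $\mathrm{Rsupp}(C)$ is the $k$-subspace of $k^n$ spanned by all $\mathrm{Rsupp}(\mathbf{c})$, $\mathbf{c}\in C$, and $\mathrm{wt}_R(C)=\dim_k\mathrm{Rsupp}(C)$.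 *)

(* Defs.v *)
From mathcomp Require Import all_boot all_order all_algebra all_field.
From mathcomp Require Import boolp classical_sets.

Set Implicit Arguments.
Unset Strict Implicit.
Unset Printing Implicit Defensive.

Import GRing.Theory.

Local Open Scope ring_scope.
Local Open Scope classical_set_scope.

Section Subspaces.

Variables (K : fieldType) (V : vectType K).

(* {vspace V} only contains detachable subspaces; classically, every subset of
   V closed under linear combinations is one of them. *)
Lemma ex_vspace_of (P : V -> Prop) : P 0 ->
    (forall (a : K) (u v : V), P u -> P v -> P (a *: u + v)) ->
  exists U : {vspace V}, forall v : V, v \in U <-> P v.
Proof.
move=> P0 PZD.
pose sub (U : {vspace V}) := forall v, v \in U -> P v.
pose Q d := `[< exists2 U : {vspace V}, sub U & \dim U = d >].
have exQ : exists d, Q d.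
  exists 0%N; apply/asboolP; exists 0%VS; last by rewrite dimv0.
  by move=> v; rewrite memv0 => /eqP->.
have ubQ d : Q d -> (d <= \dim {:V})%N.
  by case/asboolP=> U _ <-; rewrite dimvS ?subvf.
case: (ex_maxnP exQ ubQ) => d /asboolP[U subU dU] maxd.
exists U => v; split; first exact: subU.
move=> Pv; pose W := (<[v]> + U)%VS.
have subW : sub W.
  by move=> w /memv_addP[_ /vlineP[a ->] [u /subU Pu ->]]; apply: PZD.
have /eqP-> : U == W.
  rewrite eqEdim addvSr dU /=; apply: maxd; apply/asboolP.
  by exists W.
by apply/(subvP (addvSl _ _)); apply: memv_line.
Qed.

Lemma ex_span_set (A : set V) : exists U : {vspace V}, forall v : V,
  v \in U <-> exists2 s : seq V, (forall x, x \in s -> A x) & v \in <<s>>%VS.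
Proof.
apply: ex_vspace_of => [|a u v [s sA su] [t tA tv]].
  by exists [::]; rewrite ?mem0v.
exists (s ++ t); first by move=> x; rewrite mem_cat => /orP[/sA|/tA].
by rewrite span_cat memv_add ?memvZ.
Qed.

(* The subspace spanned by an arbitrary, possibly infinite, set. *)
Definition span_set (A : set V) : {vspace V} := sval (cid (ex_span_set A)).

Lemma mem_span_set (A : set V) (v : V) : v \in span_set A <->
  exists2 s : seq V, (forall x, x \in s -> A x) & v \in <<s>>%VS.
Proof. exact: (svalP (cid (ex_span_set A))). Qed.

Lemma ex_cap_set (F : set {vspace V}) : exists U : {vspace V}, forall v : V,
  v \in U <-> (forall W : {vspace V}, F W -> v \in W).
Proof.
apply: ex_vspace_of => [W _|a u v Fu Fv W FW]; first exact: mem0v.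
by rewrite memvD ?memvZ ?Fu ?Fv.
Qed.

(* The intersection of an arbitrary, possibly infinite, family of subspaces. *)
Definition cap_set (F : set {vspace V}) : {vspace V} :=
  sval (cid (ex_cap_set F)).

Lemma mem_cap_set (F : set {vspace V}) (v : V) :
  v \in cap_set F <-> (forall W : {vspace V}, F W -> v \in W).
Proof. exact: (svalP (cid (ex_cap_set F))). Qed.

End Subspaces.

Section RankSupport.

Variables (k : fieldType) (L : fieldExtType k) (n : nat).

Definition emb (x : 'rV[k]_n) : 'rV[L]_n := map_mx (in_alg L) x.

Definition extension (D : {vspace 'rV[k]_n}) : {vspace 'rV[L]_n} :=
  span_set (emb @` [set x | x \in D]).

Definition extended (E : {vspace 'rV[L]_n}) : Prop :=
  exists A : set 'rV[k]_n, E = span_set (emb @` A).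

Definition star (C : {vspace 'rV[L]_n}) : {vspace 'rV[L]_n} :=
  cap_set [set E | extended E /\ (C <= E)%VS].

Variable alpha : (\dim {:L}).-tuple L.

(* Column j holds the coordinates of c_j in alpha; meaningful when alpha is a
   k-basis of L. *)
Definition coord_mx (c : 'rV[L]_n) : 'M[k]_(\dim {:L}, n) :=
  \matrix_(i, j) coord alpha i (c 0 j).

Definition Rsupp (c : 'rV[L]_n) : {vspace 'rV[k]_n} :=
  <<[seq row i (coord_mx c) | i : 'I_(\dim {:L})]>>%VS.

Definition wtR (c : 'rV[L]_n) : nat := \dim (Rsupp c).

Definition Rsupp_space (C : {vspace 'rV[L]_n}) : {vspace 'rV[k]_n} :=
  span_set [set x | exists2 c, c \in C & x \in Rsupp c].

Definition wtR_space (C : {vspace 'rV[L]_n}) : nat := \dim (Rsupp_space C).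

End RankSupport.

(* Main.v *)
(** Expanding c in L^n along the k-basis alpha gives c = \sum_i alpha_i r_i,
    where the r_i in k^n are the rows of M(c).  Hence, for every k-subspace U
    of k^n, c lies in U_L if and only if Rsupp(c) <= U: the map c |-> r_i is
    additive and sends a u to coord_i(a) u for u in k^n.  So U_L contains C
    exactly when U contains Rsupp(C), and Rsupp(C)_L is the least extended
    subspace containing C.  The same coordinate maps show that vectors that are
    free over k remain free over L, so that dim_L U_L = dim_k U. *)
Require Import Defs.
From mathcomp Require Import all_boot all_order all_algebra all_field.
From mathcomp Require Import boolp classical_sets.

Set Implicit Arguments.
Unset Strict Implicit.
Unset Printing Implicit Defensive.

Import GRing.Theory.

Local Open Scope ring_scope.

Section SpanSet.

Variables (K : fieldType) (V : vectType K).
Implicit Types (A : set V) (U : {vspace V}).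

Lemma mem_span_set_gen A v : A v -> v \in span_set A.
Proof.
move=> Av; apply/mem_span_set; exists [:: v]; last by rewrite span_seq1 memv_line.
by move=> x; rewrite inE => /eqP->.
Qed.

Lemma span_set_subvP A U :
  (forall v, A v -> v \in U) <-> (span_set A <= U)%VS.
Proof.
split=> [AU|/subvP sAU v /mem_span_set_gen/sAU//].
apply/subvP=> v /mem_span_set[s sA]; apply/subvP/span_subvP => x /sA.
exact: AU.
Qed.

End SpanSet.

Section Extension.

Variables (k : fieldType) (L : fieldExtType k) (n : nat).
Implicit Types (U D : {vspace 'rV[k]_n}) (C E : {vspace 'rV[L]_n}).

Local Notation emb := (@emb k L n).

Lemma emb_sum I (r : seq I) (F : I -> 'rV[k]_n) :
  emb (\sum_(i <- r) F i) = \sum_(i <- r) emb (F i).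
Proof. exact: raddf_sum. Qed.

Lemma embZ (a : k) u : emb (a *: u) = a%:A *: emb u.
Proof. by rewrite /Defs.emb map_mxZ. Qed.

Lemma memv_emb U u : u \in U -> emb u \in extension L U.
Proof. by move=> uU; apply: mem_span_set_gen; exists u. Qed.

Lemma extension_subvP U E :
  (forall u, u \in U -> emb u \in E) <-> (extension L U <= E)%VS.
Proof.
split=> [UE|/subvP sUE u /memv_emb/sUE//].
by apply/span_set_subvP => _ [u uU <-]; apply: UE.
Qed.

Lemma extensionS U D : (U <= D)%VS -> (extension L U <= extension L D)%VS.
Proof. by move=> /subvP sUD; apply/extension_subvP => u /sUD; apply: memv_emb. Qed.

(** A k-linear combination of [s] becomes an L-linear one under [emb], its coefficients being read
    in L. Hence finitely many generators over k, such as a basis of [U], suffice to generate U_L. *)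
Lemma extension_span (s : seq 'rV[k]_n) :
  extension L <<s>>%VS = <<map emb s>>%VS.
Proof.
apply/eqP; rewrite eqEsubv; apply/andP; split; last first.
  by apply/span_subvP => _ /mapP[u us ->]; rewrite memv_emb ?memv_span.
apply/extension_subvP => u; rewrite -[s]in_tupleE => /coord_span->.
rewrite emb_sum memv_suml // => i _; rewrite embZ memvZ // memv_span //.
by rewrite map_f ?mem_nth.
Qed.

Lemma extension_extended U : extended (extension L U).
Proof. by exists [set x | x \in U]%classic. Qed.

(** Passing from the generating set [A] to its k-span adds nothing over L, so the family intersected
    in [star] consists of subspaces U_L only. *)
Lemma extendedE E : extended E -> exists U, E = extension L U.
Proof.
case=> A ->; exists (span_set A).
apply/eqP; rewrite eqEsubv; apply/andP; split.
  apply/span_set_subvP => _ [u Au <-].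
  by rewrite memv_emb ?mem_span_set_gen.
apply/extension_subvP => u /mem_span_set[s sA us].
apply/mem_span_set; exists (map emb s); last by rewrite -extension_span memv_emb.
by move=> _ /mapP[x /sA Ax ->]; exists x.
Qed.

Lemma subv_star C : (C <= star C)%VS.
Proof.
by apply/subvP=> c cC; apply/mem_cap_set => E [_ /subvP]; apply.
Qed.

Variable alpha : (\dim {:L}).-tuple L.
Hypothesis alpha_basis : basis_of {:L} alpha.

Lemma row_coord_mxD i (c d : 'rV[L]_n) :
  row i (coord_mx alpha (c + d)) =
  row i (coord_mx alpha c) + row i (coord_mx alpha d).
Proof. by apply/rowP=> j; rewrite !mxE linearD. Qed.

Lemma row_coord_mx0 i : row i (coord_mx alpha (0 : 'rV[L]_n)) = 0.
Proof. by apply/rowP=> j; rewrite !mxE linear0. Qed.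

Lemma row_coord_mx_sum i J (r : seq J) (F : J -> 'rV[L]_n) :
  row i (coord_mx alpha (\sum_(j <- r) F j)) =
  \sum_(j <- r) row i (coord_mx alpha (F j)).
Proof.
exact: (big_morph (fun c : 'rV[L]_n => row i (coord_mx alpha c))
          (row_coord_mxD i) (row_coord_mx0 i)).
Qed.

(** Taking coordinates is k-linear but not L-linear; here the entries of [u] are scalars of k, so
    they pass through [coord alpha i]. *)
Lemma row_coord_mx_emb i a u :
  row i (coord_mx alpha (a *: emb u)) = coord alpha i a *: u.
Proof. by apply/rowP=> j; rewrite !mxE mulr_algr linearZ mulrC. Qed.

Lemma coord_mx_expand (c : 'rV[L]_n) :
  c = \sum_(i < \dim {:L}) alpha`_i *: emb (row i (coord_mx alpha c)).
Proof.
apply/rowP=> j; rewrite summxE.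
rewrite {1}(coord_basis alpha_basis (memvf (c 0 j))).
by apply: eq_bigr => i _; rewrite !mxE mulr_algr.
Qed.

Lemma memv_extension U c : (c \in extension L U) = (Rsupp alpha c <= U)%VS.
Proof.
apply/idP/idP=> [|sU].
  rewrite -{1}(span_basis (vbasisP U)) extension_span.
  (* Write [c] as an L-combination of the embedded basis of [U]; each row of its matrix is then a
     k-combination of that basis. *)
  move=> /(coord_span (X := map_tuple emb (vbasis U)))->.
  apply/span_subvP => _ /codomP[i ->]; rewrite row_coord_mx_sum.
  apply: memv_suml => j _.
  rewrite (nth_map 0) ?size_tuple // row_coord_mx_emb memvZ //.
  by rewrite vbasis_mem ?mem_nth ?size_tuple.
rewrite [c]coord_mx_expand memv_suml // => i _; rewrite memvZ // memv_emb //.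
by apply: (subvP sU); apply: memv_span; apply: codom_f.
Qed.

Lemma subv_extension U C :
  (C <= extension L U)%VS = (Rsupp_space alpha C <= U)%VS.
Proof.
apply/idP/idP=> [/subvP CU|/span_set_subvP CU].
  apply/span_set_subvP => x [c /CU].
  by rewrite memv_extension => /subvP; apply.
apply/subvP=> c cC; rewrite memv_extension; apply/subvP=> x xc.
by apply: CU; exists c.
Qed.

Lemma free_emb (s : seq 'rV[k]_n) : free s -> free (map emb s).
Proof.
rewrite -[s]in_tupleE => /freeP s_free.
apply/(freeP (X := map_tuple emb (in_tuple s))) => a a0 j.
(* It suffices that every coordinate of [a j] vanishes: the i-th coordinates of the coefficients
   form a relation over k among the vectors of [s]. *)
rewrite (coord_basis alpha_basis (memvf (a j))) big1 // => i _.
rewrite (s_free (fun j => coord alpha i (a j))) ?scale0r //.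
rewrite -[RHS](row_coord_mx0 i) -a0 row_coord_mx_sum.
by apply: eq_bigr => l _; rewrite (nth_map 0) // row_coord_mx_emb.
Qed.

Lemma dim_extension U : \dim (extension L U) = \dim U.
Proof.
rewrite -{1}(span_basis (vbasisP U)) extension_span.
have /eqP-> := free_emb (basis_free (vbasisP U)).
by rewrite size_map size_tuple.
Qed.

Lemma star_extension C : star C = extension L (Rsupp_space alpha C).
Proof.
apply/eqP; rewrite eqEsubv; apply/andP; split; apply/subvP=> c.
  (* Rsupp(C)_L is itself a member of the family being intersected. *)
  move=> /mem_cap_set; apply; split; first exact: extension_extended.
  by rewrite subv_extension.
move=> cR; apply/mem_cap_set => _ [/extendedE[U ->]].
by rewrite subv_extension => /extensionS/subvP; apply.
Qed.

(** A subspace U_L contains [c] exactly when it contains the line of [c], so both sides lie in the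
    same subspaces [U]; each inclusion takes the other side as [U]. *)
Lemma Rsupp_space_line (c : 'rV[L]_n) : Rsupp_space alpha <[c]>%VS = Rsupp alpha c.
Proof.
apply/eqP; rewrite eqEsubv -subv_extension -!memvE memv_extension subvv /=.
by rewrite -memv_extension memvE subv_extension.
Qed.

End Extension.

Theorem proposition4p7 (k : fieldType) (L : fieldExtType k) (n : nat)
    (n_ge1 : (1 <= n)%N) (alpha : (\dim {:L}).-tuple L)
    (alpha_basis : basis_of {:L} alpha) (C : {vspace 'rV[L]_n}) :
  [/\ star C = extension L (Rsupp_space alpha C),
      \dim (star C) = wtR_space alpha C,
      (\dim C <= wtR_space alpha C)%N
    & forall c : 'rV[L]_n, \dim (star <[c]>%VS) = wtR alpha c].
Proof.
have dim_star (D : {vspace 'rV[L]_n}) : \dim (star D) = wtR_space alpha D.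
  by rewrite (star_extension alpha_basis) (dim_extension alpha_basis).
split=> [|//||c]; first exact: star_extension.
  by rewrite -dim_star dimvS ?subv_star.
by rewrite dim_star /wtR_space Rsupp_space_line.
Qed.
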